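(* For either the Square-Ulam-Warburton automaton or the Hex-Ulam-Warburton automaton, the set of all pioneers in one slice is exactly the Sierpinski gasket. That is, for each slice with its slice coordinates $(x,y)$ and all integers $x,y\ge 0$, the cell with slice coordinates $(x,y)$ is a pioneer if and only if $\binom{x+y}{x}$ is odd.
   Context: The square grid is the tiling of the plane by unit squares; the hexagonal grid is the tiling of the plane by congruent regular hexagons. The tiles are called cells. Two cells are adjacent (neighbors) if they are distinct and share a side, so each cell has $d=4$ neighbors in the square grid and $d=6$ in the hexagonal grid. The automaton (Square-UW on the square grid, Hex-UW on the hexagonal grid) evolves in discrete steps. At generation 0 exactly one cell, called the patriarch, is live; it is considered born in generation 0. For each $n\ge 0$, a cell that is not live after generation $n$ is born in generation $n+1$ (becomes live) if and only if it is adjacent to exactly one cell that is live after generation $n$; all such births happen simultaneously. Live cells never die. The Manhattan distance between two cells $a$ and $b$ of the grid is the length of the shortest path from $a$ to $b$ in which each move goes from a cell to a neighboring cell and has length 1 (all cells of the grid may be used, live or not). A pioneer is a cell that is born in some generation $n\ge 0$ and has Manhattan distance exactly $n$ from the patriarch. Slices: place the center of the patriarch at the origin and let $e_0,\dots,e_{d-1}$ be the vectors, in cyclic order, from the origin to the centers of its $d$ neighbors. For $i\in\{0,\dots,d-1\}$ (indices mod $d$), the $i$-th slice is the set of cells with centers $x e_i+y e_{i+1}$ with integers $x,y\ge 0$; $(x,y)$ are the slice coordinates. Thus there are 4 slices in the square case and 6 in the hexagonal case, and neighboring slices share the cells on their common boundary ray. The Sierpinski gasket is regarded as Pascal's triangle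 modulo 2, row by row: row $m$ ($m\ge 0$) has positions $0,\dots,m$, and position $j$ of row $m$ belongs to the gasket if and only if $\binom{m}{j}$ is odd. The gasket is placed in a slice with its top cell at the patriarch: the cell with slice coordinates $(x,y)$ corresponds to position $x$ of row $x+y$. *)

(* Defs.v *)
From mathcomp Require Import all_boot all_order all_algebra.
Set Implicit Arguments.
Unset Strict Implicit.
Unset Printing Implicit Defensive.
Import GRing.Theory.

Variant grid := Square | Hex.

(* The cell (u, v) is the tile centred at u e_0 + v e_1, where e_0 and e_1 are
   the vectors from a tile centre to the centres of two cyclically consecutive
   neighbours; in the hexagonal case they form an angle of 60 degrees.  The
   patriarch is the cell 0 = (0, 0). *)
Definition cell : Type := (int * int)%type.

(* e_0, ..., e_(d-1) in cyclic order.  In the hexagonal case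
   e_2 = e_1 - e_0 and e_(i+3) = - e_i. *)
Definition directions (g : grid) : seq cell :=
  match g with
  | Square => [:: (1, 0); (0, 1); (-1, 0); (0, -1)]
  | Hex => [:: (1, 0); (0, 1); (-1, 1); (-1, 0); (0, -1); (1, -1)]
  end%R.

Definition degree (g : grid) : nat := size (directions g).

Definition direction (g : grid) (i : nat) : cell :=
  nth 0%R (directions g) (i %% degree g).

Definition neighbors (g : grid) (a : cell) : seq cell :=
  [seq (a + v)%R | v <- directions g].

Definition adjacent (g : grid) : rel cell := fun a b => b \in neighbors g a.

(* [live g n c]: c is live after generation n.  The entries of [neighbors g c]
   are pairwise distinct, so [count] is the number of live neighbours. *)
Fixpoint live (g : grid) (n : nat) (c : cell) : bool :=
  if n is m.+1 then live g m c || (count (live g m) (neighbors g c) == 1)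
  else c == 0%R.

Definition born (g : grid) (n : nat) (c : cell) : bool :=
  if n is m.+1 then live g m.+1 c && ~~ live g m c else live g 0 c.

Definition manhattan_distance (g : grid) (a b : cell) (n : nat) : Prop :=
  (exists p : seq cell, [/\ path (adjacent g) a p, last a p = b & size p = n])
  /\ (forall p : seq cell, path (adjacent g) a p -> last a p = b -> n <= size p).

Definition pioneer (g : grid) (c : cell) : Prop :=
  exists n : nat, born g n c /\ manhattan_distance g 0%R c n.

Definition slice_cell (g : grid) (i x y : nat) : cell :=
  (direction g i *+ x + direction g i.+1 *+ y)%R.

(* Main.v *)
Require Import Defs.
From mathcomp Require Import all_boot all_order all_algebra.
From mathcomp Require Import zify.

Import GRing.Theory.

(** Both automata obey Pascal's rule at their outer front.  In every slice the
    distance of the cell (x, y) from the patriarch is x + y, and life spreads at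
    speed at most one, so after generation n all live cells lie within distance
    n ([norm_live]).  Hence a cell at distance n + 1 can have live neighbours
    only among those at distance exactly n, and in the slice these are
    (x - 1, y) and (x, y - 1).  Exactly one of two cells is live precisely when
    the exclusive or of their states is true, so the states of the cells of
    distance n at generation n satisfy the recursion of Pascal's triangle
    modulo 2 ([live_front], [live_odd_binomial]).  A cell is a pioneer exactly
    when it is live at the generation equal to its distance
    ([pioneer_slice_cell]).

    The argument is carried out with the coordinates of the first slice; the
    rotation taking each direction to the next one preserves the automaton
    ([live_rotation]) and carries the first slice to all the others.  Distances
    are read off from an explicit norm, which changes by at most one along an
    edge and equals x + y on slice cells. *)

(** The distance from the patriarch in closed form.  For [Square] this is the
    usual |u| + |v|; for [Hex] it is the largest absolute value among
    the cube coordinates u, v and - (u + v), which add up to 0; every step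
    changes two of them by one. *)
Definition norm (g : grid) (c : cell) : nat :=
  match g with
  | Square => `|c.1| + `|c.2|
  | Hex => maxn (maxn `|c.1| `|c.2|) `|(c.1 + c.2)%R|
  end.

(** The linear map taking e_0 to e_1 and e_1 to e_2: since e_2 is - e_0 in the
    square grid and e_1 - e_0 in the hexagonal grid, this is the quarter turn,
    respectively the sixth of a turn. *)
Definition rotation (g : grid) (c : cell) : cell :=
  match g with
  | Square => (- c.2, c.1)
  | Hex => (- c.2, c.1 + c.2)
  end%R.

Lemma norm_direction (g : grid) (c v : cell) :
  v \in directions g ->
  norm g (c + v)%R <= (norm g c).+1 /\ norm g c <= (norm g (c + v)%R).+1.
Proof.
case: c => a b; case: g; rewrite /= !inE.
  by case/or4P => /eqP->; rewrite /norm /=; lia.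
by rewrite !orbA => /orP[/orP[/orP[/orP[/orP[]|]|]|]|] /eqP->;
  rewrite /norm /=; lia.
Qed.

Lemma norm_rotation (g : grid) (c : cell) : norm g (rotation g c) = norm g c.
Proof. by case: g; rewrite /norm /=; lia. Qed.

Lemma rotationD (g : grid) (a b : cell) :
  (rotation g (a + b) = rotation g a + rotation g b)%R.
Proof. by case: g; congr pair; rewrite /=; lia. Qed.

Lemma rotationMn (g : grid) (a : cell) (n : nat) :
  (rotation g (a *+ n) = rotation g a *+ n)%R.
Proof.
elim: n => [|n IHn]; first by rewrite !mulr0n; case: g.
by rewrite !mulrS rotationD IHn.
Qed.

Lemma rotation_inj (g : grid) : injective (rotation g).
Proof. by move=> [a b] [c d]; case: g => -[] /= *; congr pair; lia. Qed.

Lemma rotation_directions (g : grid) :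
  map (rotation g) (directions g) = rot 1 (directions g).
Proof. by case: g. Qed.

Lemma direction_rotation (g : grid) (i : nat) :
  direction g i.+1 = rotation g (direction g i).
Proof.
rewrite /direction -addn1 -modnDml.
have : i %% degree g < degree g by rewrite ltn_mod; case: g.
by move: (i %% _); case: g => -[|[|[|[|[|[|k]]]]]].
Qed.

Lemma slice_cell_rotation (g : grid) (i x y : nat) :
  slice_cell g i.+1 x y = rotation g (slice_cell g i x y).
Proof. by rewrite /slice_cell rotationD !rotationMn -!direction_rotation. Qed.

Lemma slice_cell0 (g : grid) (x y : nat) :
  slice_cell g 0 x y = (x%:Z, y%:Z)%R.
Proof.
have -> : slice_cell g 0 x y = ((1, 0) *+ x + (0, 1) *+ y :> cell)%R by case: g.
have E1 : ((1, 0) *+ x = (x%:Z, 0) :> cell)%R.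
  by elim: x => // x IHx; rewrite mulrS IHx; congr pair; lia.
have E2 : ((0, 1) *+ y = (0, y%:Z) :> cell)%R.
  by elim: y => // y IHy; rewrite mulrS IHy; congr pair; lia.
by rewrite E1 E2; congr pair; rewrite /=; lia.
Qed.

Lemma norm_slice_cell (g : grid) (i x y : nat) :
  norm g (slice_cell g i x y) = x + y.
Proof.
elim: i => [|i IHi]; last by rewrite slice_cell_rotation norm_rotation.
by rewrite slice_cell0; case: g; rewrite /norm /=; lia.
Qed.

Lemma live_rotation (g : grid) (n : nat) (c : cell) :
  live g n (rotation g c) = live g n c.
Proof.
elim: n c => [|n IHn] c /=.
  have r0 : rotation g 0%R = 0%R by case: g.
  by rewrite -{1}r0 (inj_eq (@rotation_inj g)).
have -> : count (live g n) (neighbors g (rotation g c)) =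
          count (live g n) (neighbors g c); last by rewrite IHn.
have /permP-> : perm_eq (neighbors g (rotation g c))
                        (map (rotation g) (neighbors g c)).
  have -> : map (rotation g) (neighbors g c) =
      map (+%R (rotation g c)) (map (rotation g) (directions g)).
    by rewrite -!map_comp; apply: eq_map => v; apply: rotationD.
  by rewrite rotation_directions map_rot perm_sym perm_rot.
by rewrite count_map; apply: eq_count => d /=; apply: IHn.
Qed.

Lemma live_slice_cell (g : grid) (n i x y : nat) :
  live g n (slice_cell g i x y) = live g n (x%:Z, y%:Z)%R.
Proof.
elim: i => [|i IHi]; first by rewrite slice_cell0.
by rewrite slice_cell_rotation live_rotation.
Qed.

(** A newly born cell has a live neighbour, so the radius of the live region
    grows by at most one per generation. *)
Lemma norm_live (g : grid) (n : nat) (c : cell) : live g n c -> norm g c <= n.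
Proof.
elim: n c => [|n IHn] c /=; first by move=> /eqP->; case: g.
case/orP => [/IHn/leqW //|/eqP count1].
have /hasP[d /mapP[v v_dir ->] /IHn le_n] : has (live g n) (neighbors g c).
  by rewrite has_count count1.
by apply: leq_trans (norm_direction _ c _ v_dir).2 _.
Qed.

Lemma live_far (g : grid) (n : nat) (c : cell) :
  n < norm g c -> live g n c = false.
Proof. by move=> lt_n; apply/negP => /norm_live; rewrite leqNgt lt_n. Qed.

(** Apart from (x - 1, y) and (x, y - 1), every neighbour of a cell at distance
    n + 1 is itself too far away to be live.  On a boundary ray one of these two
    lies outside the slice; it is then too far away as well, so that the formula
    holds there without change. *)
Lemma live_front (g : grid) (n x y : nat) :
  x + y = n.+1 ->
  live g n.+1 (x%:Z, y%:Z)%R =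
    live g n (x%:Z - 1, y%:Z)%R (+) live g n (x%:Z, y%:Z - 1)%R.
Proof.
move=> xy /=; rewrite live_far; last by case: g; rewrite /norm /=; lia.
have far a b : n < norm g (a, b) -> live g n (a, b) = false by apply: live_far.
have addE (a b c d : int) : ((a, b) + (c, d) = (a + c, b + d) :> cell)%R by [].
case: g far => far; rewrite /neighbors /= !addE !addr0.
  rewrite (far (x%:Z + 1)%R) ?(far _ (y%:Z + 1)%R) /norm /=; lia.
rewrite (far (x%:Z + 1)%R y) ?(far x (y%:Z + 1)%R)
  ?(far _ (y%:Z + 1)%R) ?(far (x%:Z + 1)%R) /norm /=; lia.
Qed.

Lemma live_odd_binomial (g : grid) (x y : nat) :
  live g (x + y) (x%:Z, y%:Z)%R = odd 'C(x + y, x).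
Proof.
move En: (x + y) => n; elim: n x y En => [|n IHn] x y xy.
  by have [-> ->] : x = 0 /\ y = 0 by lia.
rewrite live_front //.
have predZ k : (k.+1%:Z - 1 = k%:Z)%R by lia.
case: x y xy => [|x] [|y] // xy.
- rewrite predZ IHn ?bin0; last by lia.
  by rewrite live_far //; case: (g); rewrite /norm /=; lia.
- rewrite predZ IHn; last by lia.
  rewrite live_far; last by case: (g); rewrite /norm /=; lia.
  by have -> : x = n by [lia]; rewrite !binn.
- by rewrite !predZ !IHn ?binS ?oddD 1?addbC //; lia.
Qed.

Lemma norm_last_path (g : grid) (a : cell) (p : seq cell) :
  path (adjacent g) a p -> norm g (last a p) <= norm g a + size p.
Proof.
elim: p a => [|b p IHp] a /=; first by rewrite addn0.
case/andP => /mapP[v v_dir ->] /IHp le_last.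
apply: leq_trans le_last _; rewrite addnS -addSn leq_add2r.
exact: (norm_direction _ a _ v_dir).1.
Qed.

Lemma adjacent_direction (g : grid) (c : cell) (i : nat) :
  adjacent g c (c + direction g i)%R.
Proof. by apply/map_f/mem_nth; rewrite ltn_mod; case: g. Qed.

(** A shortest path first follows the ray of e_i, then the direction e_(i+1). *)
Lemma slice_path (g : grid) (i x y : nat) :
  exists p : seq cell, [/\ path (adjacent g) 0%R p,
    last 0%R p = slice_cell g i x y & size p = x + y].
Proof.
have extend (c : cell) j n :
    (exists p, [/\ path (adjacent g) 0%R p, last 0%R p = c & size p = n]) ->
  exists p, [/\ path (adjacent g) 0%R p,
    last 0%R p = (c + direction g j)%R & size p = n.+1].
  case=> p [p_path p_last p_size]; exists (rcons p (c + direction g j)%R).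
  by rewrite rcons_path p_path p_last last_rcons size_rcons p_size
    adjacent_direction.
elim: y => [|y IHy]; last first.
  by rewrite addnS /slice_cell mulrSr addrA; apply: extend.
rewrite addn0 /slice_cell mulr0n addr0.
elim: x => [|x IHx]; first by exists [::].
by rewrite mulrSr; apply: extend.
Qed.

Lemma manhattan_distance_slice_cell (g : grid) (i x y n : nat) :
  manhattan_distance g 0%R (slice_cell g i x y) n <-> n = x + y.
Proof.
have far p : path (adjacent g) 0%R p -> last 0%R p = slice_cell g i x y ->
    x + y <= size p.
  move=> /norm_last_path + p_last; rewrite p_last norm_slice_cell.
  by case: (g).
have [q [q_path q_last q_size]] := slice_path g i x y.
split=> [[[p [p_path p_last <-]] minimal]|->]; last by split; first by exists q.
by apply/eqP; rewrite eqn_leq far // andbT -q_size minimal // q_size.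
Qed.

(** A cell cannot be live before the generation equal to its distance, so being
    live at that generation already means being born then. *)
Lemma pioneer_slice_cell (g : grid) (i x y : nat) :
  pioneer g (slice_cell g i x y) <-> live g (x + y) (slice_cell g i x y).
Proof.
have bornE : born g (x + y) (slice_cell g i x y) =
             live g (x + y) (slice_cell g i x y).
  case E: (x + y) => [//|m]; rewrite /born (live_far g m) ?andbT //.
  by rewrite norm_slice_cell E.
rewrite -bornE; split=> [[n [n_born /manhattan_distance_slice_cell En]]|].
  by rewrite -En.
by exists (x + y); split=> //; apply/manhattan_distance_slice_cell.
Qed.

Theorem theorem7 (g : grid) (i : nat) (hi : i < degree g) (x y : nat) :
  pioneer g (slice_cell g i x y) <-> odd 'C(x + y, x).
Proof.
by rewrite -(live_odd_binomial g) -(live_slice_cell g _ i);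
  apply: pioneer_slice_cell.
Qed.
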